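(* Let $N\ge2$ and $l\in\{0,1,\ldots,N\}$, and let $e_l$ be the $l$-th elementary symmetric polynomial in $N$ variables. For every $k\in\,]0,\infty[$, $e_l$ is an eigenfunction of $$\widetilde H_k=\frac1k\Bigl(-\sum_{j=1}^N z_j^2\frac{\partial^2}{\partial z_j^2}-(1-k(N-1))\sum_{j=1}^N z_j\frac{\partial}{\partial z_j}-2k\sum_{j=1}^N\sum_{m\ne j}\frac{z_j^2}{z_j-z_m}\frac{\partial}{\partial z_j}\Bigr)$$ with eigenvalue $-l\bigl(\frac1k+N-l\bigr)$, i.e. $\widetilde H_k e_l=-l(\frac1k+N-l)\,e_l$. Moreover, $e_l$ is an eigenfunction of $$\widetilde H_\infty=(N-1)\sum_{j=1}^N z_j\frac{\partial}{\partial z_j}-2\sum_{j=1}^N\sum_{m\ne j}\frac{z_j^2}{z_j-z_m}\frac{\partial}{\partial z_j}$$ with eigenvalue $-l(N-l)$.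
   Context: The elementary symmetric polynomials are determined by $\prod_{j=1}^N(y-z_j)=\sum_{l=0}^N(-1)^le_l(z)\,y^{N-l}$. The operators act on permutation-invariant functions of $z=(z_1,\ldots,z_N)$; the singular expressions are understood at points with pairwise distinct coordinates (and extended by continuity). The operator $\widetilde H_k$ is the compact type-$A_{N-1}$ Heckman-Opdam Laplacian, divided by $k$, in the coordinates $z_j=e^{ix_j}$. *)

(* Defs.v *)
From mathcomp Require Import all_boot all_order all_algebra all_fingroup.
From mathcomp Require Import all_classical all_reals all_analysis.
(* Not imported: its notations clash with those of mathcomp-analysis. *)
From mathcomp Require mpoly.

Set Implicit Arguments.
Unset Strict Implicit.
Unset Printing Implicit Defensive.

Import Order.TTheory GRing.Theory Num.Theory.
Import numFieldNormedType.Exports.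

Local Open Scope classical_set_scope.
Local Open Scope ring_scope.

(* Everything is stated over a numFieldType K, to be instantiated with the
   complex numbers R[i]; 'D_v is then the complex directional derivative. *)

Definition elem_sym (K : numFieldType) (N l : nat) (z : 'rV[K]_N) : K :=
  mpoly.meval (fun j => z 0 j) (mpoly.mesym N K l).

Lemma elem_sym_generating (K : numFieldType) (N : nat) (z : 'rV[K]_N) :
  \prod_(j < N) ('X - (z 0 j)%:P) =
  \sum_(l < N.+1) ((-1) ^+ l * elem_sym l z) *: 'X^(N - l).
Proof.
have eprod : \prod_(j < N) ('X - (z 0 j)%:P) =
    \prod_(c <- [tuple z 0 j | j < N]) ('X - c%:P).
  rewrite big_tuple; apply: eq_bigr => j _.
  by rewrite tnth_mktuple.
have szp : size (\prod_(j < N) ('X - (z 0 j)%:P)) = N.+1.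
  by rewrite eprod size_prod_XsubC size_tuple.
rewrite -[LHS]coefK poly_def szp (reindex_inj rev_ord_inj) /=.
apply: eq_bigr => l _; rewrite subSS; congr (_ *: _).
rewrite eprod mpoly.mroots_coeff /elem_sym; congr (_ * _).
by apply: mpoly.meval_eq => j; rewrite tnth_mktuple.
Qed.

Definition partial (K : numFieldType) (N : nat) (j : 'I_N)
    (f : 'rV[K]_N -> K) : 'rV[K]_N -> K :=
  fun z => 'D_(delta_mx 0 j) f z.

Definition distinct_coords (K : numFieldType) (N : nat) : set 'rV[K]_N :=
  [set z | forall i j : 'I_N, i != j -> z 0 i != z 0 j].

(* The extension by continuity, to all of K^N, of an expression F that is
   meaningful only at points with pairwise distinct coordinates. *)
Definition extend_by_continuity (K : numFieldType) (N : nat)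
    (F : 'rV[K]_N -> K) : 'rV[K]_N -> K :=
  fun z => if `[< distinct_coords z >] then F z
           else lim (F w @[w --> within (@distinct_coords K N) (nbhs z)]).

Definition Htilde (K : numFieldType) (N : nat) (k : K)
    (f : 'rV[K]_N -> K) : 'rV[K]_N -> K :=
  extend_by_continuity (fun z =>
    k^-1 *
    (- (\sum_(j < N) z 0 j ^+ 2 * partial j (partial j f) z)
     - (1 - k * (N%:R - 1)) * (\sum_(j < N) z 0 j * partial j f z)
     - 2 * k * (\sum_(j < N) \sum_(m < N | m != j)
                  z 0 j ^+ 2 / (z 0 j - z 0 m) * partial j f z))).

Definition Htilde_infty (K : numFieldType) (N : nat)
    (f : 'rV[K]_N -> K) : 'rV[K]_N -> K :=
  extend_by_continuity (fun z =>
    (N%:R - 1) * (\sum_(j < N) z 0 j * partial j f z)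
    - 2 * (\sum_(j < N) \sum_(m < N | m != j)
             z 0 j ^+ 2 / (z 0 j - z 0 m) * partial j f z)).

Definition perm_invariant (K : numFieldType) (N : nat)
    (f : 'rV[K]_N -> K) : Prop :=
  forall (s : 'S_N) (z : 'rV[K]_N), f (col_perm s z) = f z.

(* As 'D_v and lim are total functions, being an eigenfunction includes the
   existence of the partial derivatives that occur in the operators, and the
   continuity of H f, i.e. that the singular expression does extend. *)
Definition is_eigenfunction (K : numFieldType) (N : nat)
    (H : ('rV[K]_N -> K) -> 'rV[K]_N -> K) (f : 'rV[K]_N -> K)
    (lambda : K) : Prop :=
  [/\ perm_invariant f,
      forall (j : 'I_N) (z : 'rV[K]_N),
        derivable f z (delta_mx 0 j) /\
        derivable (partial j f) z (delta_mx 0 j),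
      exists z, f z != 0,
      continuous (H f) &
      forall z, H f z = lambda * f z].

(* Main.v *)
(** Since [e_l] has degree at most one in each variable, its pure second
    derivatives vanish, and Euler's identity handles the first-order term. For
    the singular term, symmetrise in [(j, m)]. With [D_j] the first and [D_jm]
    the mixed second derivative of [e_l],
    [D_j - D_m = - (z_j - z_m) D_jm], hence
    [(z_j^2 D_j - z_m^2 D_m) / (z_j - z_m) = z_j D_j + z_m D_m - z_j z_m D_jm],
    and both sums on the right are again given by Euler's identity. The result
    [lambda * e_l] is continuous and the points with distinct coordinates are
    dense, so the identity persists for the extension by continuity. *)

Require Import Defs.
From mathcomp Require Import all_boot all_order all_algebra all_fingroup.
From mathcomp Require Import all_classical all_reals all_analysis complex.
From mathcomp Require mpoly.
From mathcomp Require Import ring finset.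
Import Order.TTheory GRing.Theory Num.Theory.
Import numFieldNormedType.Exports.
Local Open Scope ring_scope.
Local Open Scope complex_scope.

Set Implicit Arguments.
Unset Strict Implicit.
Unset Printing Implicit Defensive.

(** * Algebra of elementary symmetric polynomials with variables removed *)

Section PuncturedElemSym.
Variables (K : comPzRingType) (N l : nat).
Implicit Types (z : 'I_N -> K) (P B : {set 'I_N}) (c : nat) (i j m : 'I_N).

(* For [P] of cardinality [c], the derivative of [e_l] once in each variable
   indexed by [P]. *)
Definition punctured_esym P c z : K :=
  \sum_(B : {set 'I_N} | [disjoint B & P] && (#|B| + c == l)%N)
    \prod_(i in B) z i.

Lemma disjoint_setU1r P B j :
  [disjoint B & j |: P] = (j \notin B) && [disjoint B & P].
Proof.
by rewrite ![[disjoint B & _]]disjoint_sym !disjoints_subset subUset sub1set inE.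
Qed.

(** Multiplication by [z j] inserts [j] into each subset: [B] maps to [j |: B] bijectively from the
    subsets avoiding [j] to those containing it, and [c.+1] absorbs the growth of [#|B|]. *)
Lemma punctured_esym_containing P c z j : j \notin P ->
  z j * punctured_esym (j |: P) c.+1 z =
  \sum_(B : {set 'I_N} | [&& [disjoint B & P], (#|B| + c == l)%N & j \in B])
    \prod_(i in B) z i.
Proof.
move=> jP; rewrite mulr_sumr [RHS](reindex_onto (fun B => j |: B) (fun B => B :\ j)) /=.
  apply: eq_big => [B|B].
    rewrite disjoint_setU1r [[disjoint _ |: _ & _]]disjoint_sym disjoint_setU1r jP.
    rewrite (disjoint_sym P) setU11 cardsU1 andbT /=.
    have [jB|jB] := boolP (j \in B); last first.
      by rewrite setU1K // eqxx andbT add1n addSn addnS.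
    (* A [B] that already contains [j] is not recovered by removing [j] from [j |: B], so it is
       excluded on both sides. *)
    apply/esym/andP => -[_ /eqP e].
    by move: (setD11 j (j |: B)); rewrite e jB.
  by rewrite disjoint_setU1r => /andP[/andP[jB _] _]; rewrite big_setU1.
by move=> B /and3P[_ _ jB]; rewrite setD1K.
Qed.

(** Sorting the subsets by whether they contain [j] exhibits an affine function of [z j], since
    neither [punctured_esym] on the right involves [z j]. *)
Lemma punctured_esym_split P c z j : j \notin P ->
  punctured_esym P c z =
  punctured_esym (j |: P) c z + z j * punctured_esym (j |: P) c.+1 z.
Proof.
move=> jP; rewrite punctured_esym_containing // /punctured_esym.
rewrite (bigID (fun B : {set 'I_N} => j \in B)) /= addrC; congr (_ + _).
  by apply: eq_bigl => B; rewrite disjoint_setU1r andbC andbA.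
by apply: eq_bigl => B; rewrite andbA.
Qed.

(** Double counting: after exchanging the sums, each [B] occurs once for every [j] in it, hence
    [l - c] times. *)
Lemma punctured_esym_euler P c z :
  \sum_(j | j \notin P) z j * punctured_esym (j |: P) c.+1 z =
  (l%:R - c%:R) * punctured_esym P c z.
Proof.
under eq_bigr => j jP do rewrite punctured_esym_containing //.
rewrite (exchange_big_dep
  (fun B : {set 'I_N} => [disjoint B & P] && (#|B| + c == l)%N)) /=; last first.
  by move=> j B _ /and3P[-> ->].
rewrite mulr_sumr; apply: eq_bigr => B /andP[dB /eqP cB].
rewrite [LHS](eq_bigl (fun j => j \in B)); last first.
  move=> j /=; rewrite dB cB eqxx /=; have [jB|_] := boolP (j \in B); last by rewrite andbF.
  by rewrite (disjointFr dB jB).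
by rewrite sumr_const -cB natrD addrK mulr_natl.
Qed.

(* The part of the left-hand side free of both variables is symmetric
   in [i] and [j]. *)
Lemma punctured_esym_diff c z i j : i != j ->
  punctured_esym [set i] c z - punctured_esym [set j] c z =
  (z j - z i) * punctured_esym [set i; j] c.+1 z.
Proof.
move=> ij.
rewrite (@punctured_esym_split [set i] c z j) ?inE 1?eq_sym //.
rewrite (@punctured_esym_split [set j] c z i) ?inE // (setUC [set j]).
by ring.
Qed.

End PuncturedElemSym.

Lemma punctured_esym_local (K : comPzRingType) (N l c : nat) (P : {set 'I_N})
    (z z' : 'I_N -> K) :
  {in ~: P, z =1 z'} -> punctured_esym l P c z = punctured_esym l P c z'.
Proof.
move=> zz'; apply: eq_bigr => B /andP[dB _]; apply: eq_bigr => i iB.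
by apply: zz'; rewrite inE (disjointFr dB iB).
Qed.

Lemma esym_euler (K : comPzRingType) (N l : nat) (z : 'I_N -> K) :
  \sum_(j < N) z j * punctured_esym l [set j] 1 z = l%:R * punctured_esym l set0 0 z.
Proof.
rewrite -[l%:R]subr0 -(punctured_esym_euler l set0 0 z).
by apply: eq_big => [j|j _]; rewrite ?inE // setU0.
Qed.

Lemma esym_singular_sum (K : fieldType) (N l : nat) (z : 'I_N -> K) :
  (forall i j, i != j -> z i != z j) ->
  2 * (\sum_(j < N) \sum_(m < N | m != j)
         z j ^+ 2 / (z j - z m) * punctured_esym l [set j] 1 z) =
  l%:R * (2 * N%:R - l%:R - 1) * punctured_esym l set0 0 z.
Proof.
move=> z_inj; set D := fun j => punctured_esym l [set j] 1 z.
have euler1 : \sum_(j < N) z j * D j = l%:R * punctured_esym l set0 0 z.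
  exact: esym_euler.
(* Euler's identity for [D j], which is homogeneous of degree [l - 1]. *)
have euler2 j : \sum_(m < N | m != j) z m * punctured_esym l [set j; m] 2 z =
    (l%:R - 1) * D j.
  rewrite -[1]/(1%:R) -(punctured_esym_euler l [set j] 1 z).
  by apply: eq_big => [m|m _]; rewrite ?inE // setUC.
have cardN1 (j : 'I_N) : #|[pred m : 'I_N | m != j]|%:R = N%:R - 1 :> K.
  have := cardC1 j; rewrite card_ord => ->.
  by case: N j {z z_inj D euler1 euler2} => [[]//|n] j /=; rewrite -addn1 natrD addrK.
(* The factor 2 supplies two copies of the double sum; exchanging the indices in one of them
   produces the symmetrised terms of [pair]. *)
rewrite -[2]/(1 + 1) mulrDl !mul1r.
rewrite [X in _ + X](exchange_big_dep xpredT) //= -big_split /=.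
have pair j : (\sum_(m < N | m != j) z j ^+ 2 / (z j - z m) * D j) +
    (\sum_(m < N | j != m) z m ^+ 2 / (z m - z j) * D m) =
    \sum_(m < N | m != j) (z j * D j + z m * D m
                          - z j * (z m * punctured_esym l [set j; m] 2 z)).
  rewrite (eq_bigl (fun m => m != j)) => [|m]; last by rewrite eq_sym.
  rewrite [X in _ + X](eq_bigl (fun m => m != j)) => [|m]; last by rewrite eq_sym.
  rewrite -big_split /=; apply: eq_bigr => m mj.
  have z0 : z j - z m != 0 by rewrite subr_eq0 z_inj // eq_sym.
  have z0' : z m - z j != 0 by rewrite subr_eq0 z_inj.
  have -> : D m = D j - (z m - z j) * punctured_esym l [set j; m] 2 z.
    by rewrite -punctured_esym_diff ?(eq_sym j) // opprB addrC subrK.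
  by field; rewrite z0 z0'.
rewrite (eq_bigr _ (fun j _ => pair j)).
under eq_bigr => j _ do rewrite sumrB big_split /= sumr_const -mulr_sumr euler2.
rewrite sumrB big_split /=.
under eq_bigr => j _ do rewrite -mulr_natl cardN1.
rewrite -mulr_sumr euler1.
rewrite [X in _ + X - _](exchange_big_dep xpredT) //=.
under [X in _ + X - _]eq_bigr => j _.
  rewrite sumr_const (eq_card (B := [pred m | m != j])) => [|m]; last by rewrite !inE eq_sym.
  rewrite -mulr_natl cardN1; over.
rewrite -mulr_sumr euler1.
under eq_bigr => j _ do rewrite mulrCA.
rewrite -mulr_sumr euler1.
(* The three sums contribute [N - 1], [N - 1] and [-(l - 1)] times [l * e_l], which add up to
   [2N - l - 1] times it. *)
by ring.
Qed.

Lemma elem_symE (K : numFieldType) (N l : nat) (z : 'rV[K]_N) :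
  elem_sym l z = punctured_esym l set0 0 (z 0).
Proof.
rewrite /elem_sym mpoly.mesymE (big_morph _ (mpoly.mevalD _) (mpoly.meval0 _)).
apply: eq_big => [B|B _]; first by rewrite addn0 disjoint_sym disjoints_subset sub0set.
rewrite mpoly.mevalX [RHS]big_mkcond; apply: eq_bigr => i _.
by rewrite mpoly.mnmE; case: (i \in B); rewrite ?expr1 ?expr0.
Qed.

Lemma elem_sym_perm_invariant (K : numFieldType) (N l : nat) :
  perm_invariant (@elem_sym K N l).
Proof.
move=> s z; rewrite !elem_symE /punctured_esym.
rewrite [RHS](reindex_inj (imset_inj (@perm_inj _ s))) /=.
apply: eq_big => [B|B _].
  by rewrite !(disjoint_sym _ set0) !disjoints_subset !sub0set card_imset //; exact: perm_inj.
rewrite big_imset /=; last by move=> i j _ _; exact: perm_inj.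
by apply: eq_bigr => i _; rewrite mxE.
Qed.

(** Provides the point where [e_l] is nonzero: the binomial coefficient is positive for [l <= N]. *)
Lemma elem_sym_const1 (K : numFieldType) (N l : nat) :
  elem_sym l (const_mx 1 : 'rV[K]_N) = 'C(N, l)%:R.
Proof.
rewrite elem_symE /punctured_esym (eq_bigr (fun=> 1)) => [|B _]; last first.
  by rewrite big1 // => i _; rewrite mxE.
rewrite sumr_const -[in RHS](card_ord N) -card_draws; congr _%:R.
by apply: eq_card => B; rewrite inE unfold_in addn0 disjoint_sym disjoints_subset sub0set.
Qed.

Lemma continuous_elem_sym (K : numFieldType) (N l : nat) :
  continuous (@elem_sym K N l).
Proof.
have -> : @elem_sym K N l =
    fun z => \sum_(B : {set 'I_N} | [disjoint B & set0] && (#|B| + 0 == l)%N)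
               \prod_(i in B) z 0 i.
  by apply/funext => z; rewrite elem_symE.
apply: continuous_big => [|B _]; first exact: add_continuous.
apply: continuous_big => [|i _]; first exact: mul_continuous.
exact: coord_continuous.
Qed.

(** * Derivatives along lines, and extension by continuity *)

Section Topology.
Local Open Scope classical_set_scope.

(** The difference quotient is constantly [d] for nonzero [h]. *)
Lemma is_derive_affine (K : numFieldType) (V : normedModType K) (f : V -> K)
    (a v : V) (d : K) :
  (forall h : K, f (h *: v + a) = f a + h * d) -> is_derive a v f d.
Proof.
move=> fE.
have quot : (fun h => h^-1 *: ((f \o shift a) (h *: v) - f a)) @ 0^' --> d.
  apply: (@cvg_trans _ (cst d @ 0^')); last exact: cvg_cst.
  apply: near_eq_cvg.
  near=> h.
  have h0 : h != 0 by near: h; exact: nbhs_dnbhs_neq.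
  by rewrite /= fE addrC addKr -[_ *: _]/(_ * _) mulKf.
split; first exact: cvgP quot.
exact: (cvg_lim (@norm_hausdorff _ _)).
Unshelve. all: by end_near. Qed.

(** This is the density of the points with distinct coordinates; it makes the limit in
    [extend_by_continuity] unique. *)
Lemma distinct_coords_proper_within (K : numFieldType) (N : nat) (z : 'rV[K]_N) :
  ProperFilter (within (@distinct_coords K N) (nbhs z)).
Proof.
apply: Build_ProperFilter_ex => A.
rewrite /within /= => nA.
(* The slopes 0, 1, ..., N-1 are distinct in characteristic zero, so two given coordinates of [w t]
   agree for at most one [t]. *)
pose w (t : K) : 'rV[K]_N := z + t *: \row_i i%:R.
have w0 : w t @[t --> 0^'] --> z.
  have : w t @[t --> (0 : K)^'] --> z + (0 : K) *: \row_(i < N) i%:R.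
    apply: cvg_within_filter; apply: cvgD; first exact: cvg_cst.
    by apply: cvgZl; exact: cvg_id.
  by rewrite scale0r addr0.
have dw : \forall t \near 0^', distinct_coords (w t).
  apply: filter_forall => i; apply: filter_forall => j.
  have [->|ij] := eqVneq i j; first exact: nearW.
  (* The only [t] at which coordinates [i] and [j] of [w t] agree. *)
  pose c : K := (z 0 j - z 0 i) / (i%:R - j%:R).
  have ij0 : (i%:R - j%:R : K) != 0 by rewrite subr_eq0 eqr_nat.
  have : \forall t \near 0^', t != c.
    (* If [c] is 0, the punctured neighbourhood omits it; otherwise the complement of [c] is a
       neighbourhood of 0. *)
    have [->|c0] := eqVneq c 0; first exact: nbhs_dnbhs_neq.
    have : \forall t \near (0 : K), (~` [set c]) t.
      apply: open_nbhs_nbhs; split; last by move/eqP; rewrite eq_sym (negPf c0).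
      apply/closed_openC/accessible_closed_set1/hausdorff_accessible.
      exact: norm_hausdorff.
    by move/nbhs_dnbhs; apply: filterS => t /eqP.
  apply: filterS => t tc _; rewrite !mxE; apply: contra tc => /eqP e.
  rewrite /c eq_sym; apply/eqP; rewrite -[RHS](mulfK ij0); congr (_ / _).
  by apply/eqP; rewrite mulrBr subr_eq addrAC -subr_eq opprK -e addrC.
have /filter_ex[t At] : \forall t \near 0^', A (w t).
  by apply: filterS2 dw (w0 _ nA) => t dt; apply.
by exists (w t).
Qed.

Lemma extend_by_continuity_eq (K : numFieldType) (N : nat) (F g : 'rV[K]_N -> K) :
  continuous g -> (forall z, distinct_coords z -> F z = g z) ->
  extend_by_continuity F = g.
Proof.
move=> gc Fg; apply/funext => z; rewrite /extend_by_continuity.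
case: asboolP => [/Fg//|_].
have pf := distinct_coords_proper_within z.
apply: (cvg_lim (@norm_hausdorff _ _)).
apply: (@cvg_trans _ (g w @[w --> within (@distinct_coords K N) (nbhs z)])).
  by apply: near_eq_cvg; apply: filterS (withinT _ _) => w /Fg.
by apply: cvg_within_filter; exact: gc.
Qed.

End Topology.

(** * Partial derivatives of [e_l] *)

Section Partials.
Variables (K : numFieldType) (N l : nat) (j : 'I_N).

Let shift_off (h : K) (z : 'rV[K]_N) :
  {in ~: [set j], (h *: delta_mx 0 j + z) 0 =1 z 0}.
Proof.
by move=> i; rewrite !inE => ij; rewrite !mxE eqxx (negPf ij) mulr0 add0r.
Qed.

Lemma is_derive_elem_sym (z : 'rV[K]_N) :
  is_derive z (delta_mx 0 j) (@elem_sym K N l) (punctured_esym l [set j] 1 (z 0)).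
Proof.
apply: is_derive_affine => h; rewrite !elem_symE.
rewrite !(@punctured_esym_split _ _ _ set0 _ _ j) ?inE // setU0.
rewrite !(punctured_esym_local _ _ (shift_off h z)) !mxE !eqxx /=.
by ring.
Qed.

Lemma partial_elem_sym :
  partial j (@elem_sym K N l) = fun z => punctured_esym l [set j] 1 (z 0).
Proof.
by apply/funext => z; apply: derive_val; exact: is_derive_elem_sym.
Qed.

(** The first partial derivative no longer involves [z j], so it is constant along that
    direction. *)
Lemma is_derive_partial_elem_sym (z : 'rV[K]_N) :
  is_derive z (delta_mx 0 j) (partial j (@elem_sym K N l)) 0.
Proof.
rewrite partial_elem_sym; apply: is_derive_affine => h.
by rewrite (punctured_esym_local _ _ (shift_off h z)) mulr0 addr0.
Qed.

Lemma partial_partial_elem_sym (z : 'rV[K]_N) :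
  partial j (partial j (@elem_sym K N l)) z = 0.
Proof. by apply: derive_val; exact: is_derive_partial_elem_sym. Qed.

End Partials.

(** * Action of the two operators on [e_l] *)

Section Operators.
Variables (K : numFieldType) (N l : nat).

Lemma sum_partial_elem_sym (z : 'rV[K]_N) :
  \sum_(j < N) z 0 j * partial j (@elem_sym K N l) z = l%:R * elem_sym l z.
Proof.
under eq_bigr => j _ do rewrite partial_elem_sym.
by rewrite elem_symE esym_euler.
Qed.

Lemma sum_singular_elem_sym (z : 'rV[K]_N) : distinct_coords z ->
  2 * (\sum_(j < N) \sum_(m < N | m != j)
         z 0 j ^+ 2 / (z 0 j - z 0 m) * partial j (@elem_sym K N l) z) =
  l%:R * (2 * N%:R - l%:R - 1) * elem_sym l z.
Proof.
move=> z_inj; rewrite elem_symE -(esym_singular_sum l z_inj); congr (2 * _).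
by apply: eq_bigr => j _; apply: eq_bigr => m _; rewrite partial_elem_sym.
Qed.

Lemma continuous_scaled_elem_sym (lambda : K) :
  continuous (fun z : 'rV[K]_N => lambda * elem_sym l z).
Proof.
move=> z; apply: (@cvgM _ _ (nbhs z) _ (cst lambda) (@elem_sym K N l)).
  exact: cvg_cst.
exact: continuous_elem_sym.
Qed.

Lemma is_eigenfunction_elem_sym (H : ('rV[K]_N -> K) -> 'rV[K]_N -> K) lambda :
  (l <= N)%N -> H (@elem_sym K N l) = (fun z => lambda * elem_sym l z) ->
  is_eigenfunction H (@elem_sym K N l) lambda.
Proof.
move=> lN HE; split; last by move=> z; rewrite HE.
- exact: elem_sym_perm_invariant.
- move=> j z; split; first by case: (is_derive_elem_sym l j z).
  by case: (is_derive_partial_elem_sym l j z).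
- by exists (const_mx 1); rewrite elem_sym_const1 pnatr_eq0 -lt0n bin_gt0.
- by rewrite HE; exact: continuous_scaled_elem_sym.
Qed.

Lemma Htilde_elem_sym (k : K) : k != 0 ->
  Htilde k (@elem_sym K N l) =
  fun z => - (l%:R * (k^-1 + N%:R - l%:R)) * elem_sym l z.
Proof.
move=> k0; apply: extend_by_continuity_eq => [|z dz].
  exact: continuous_scaled_elem_sym.
rewrite big1 => [|j _]; last first.
  by rewrite partial_partial_elem_sym mulr0.
(* [mulrAC] moves [k] outward to expose twice the singular sum. What remains is [-(1/k - (N - 1)) *
   l - l * (2N - l - 1) = -l * (1/k + N - l)]. *)
rewrite sum_partial_elem_sym mulrAC sum_singular_elem_sym //.
by field.
Qed.

Lemma Htilde_infty_elem_sym :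
  Htilde_infty (@elem_sym K N l) =
  fun z => - (l%:R * (N%:R - l%:R)) * elem_sym l z.
Proof.
apply: extend_by_continuity_eq => [|z dz].
  exact: continuous_scaled_elem_sym.
by rewrite sum_partial_elem_sym sum_singular_elem_sym //; ring.
Qed.

End Operators.

Theorem mainTheorem4 (R : realType) (N l : nat) (hN : (2 <= N)%N)
    (hl : (l <= N)%N) :
  (forall k : R, 0 < k ->
     is_eigenfunction (@Htilde R[i] N k%:C) (@elem_sym R[i] N l)
       (- (l%:R * (k%:C^-1 + N%:R - l%:R))))
  /\ is_eigenfunction (@Htilde_infty R[i] N) (@elem_sym R[i] N l)
       (- (l%:R * (N%:R - l%:R))).
Proof.
split=> [k k0|]; apply: is_eigenfunction_elem_sym => //.
  by apply: Htilde_elem_sym; rewrite fmorph_eq0 gt_eqF.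
exact: Htilde_infty_elem_sym.
Qed.
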